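(* Suppose that (Condition 1) every reduced graph of $G(\mathcal{V},\mathcal{E})$ contains a unique source component; and (Assumption 1) for any $\theta,\theta^{*}\in\Theta$ with $\theta\neq\theta^{*}$, and for any reduced graph $\mathcal{H}$ of $G(\mathcal{V},\mathcal{E})$ with $\mathcal{S}_{\mathcal{H}}$ denoting its unique source component, $$\sum_{i\in \mathcal{S}_{\mathcal{H}}} D\big(\ell_i(\cdot|\theta^{*})\,\|\,\ell_i(\cdot|\theta)\big)\neq 0 .$$ Then each non-faulty agent $i\in\mathcal{N}$, running the belief update protocol described in the context, learns the true hypothesis $\theta^{*}$ almost surely, i.e. $$\mu^i_t(\theta^{*})\xrightarrow{\text{a.s.}} 1 \quad (t\to\infty)\qquad \text{for all } i\in\mathcal{N}.$$
   Context: Network. A collection of $n$ agents is connected by a directed network $G(\mathcal{V},\mathcal{E})$, $\mathcal{V}=\{1,\dots,n\}$; $\mathcal{I}_i$ is the set of incoming neighbors of agent $i$. The system is asynchronous: message delays can be arbitrarily long but are finite. In any execution, up to $f$ agents suffer crash faults (cease operating). $\mathcal{N}\subseteq\mathcal{V}$ is the set of non-faulty agents of the given execution, so $|\mathcal{V}\setminus\mathcal{N}|\le f$. $\mathcal{N}[t]$ is the set of agents that have not crashed by the beginning of iteration $t$, and $\bar{\mathcal{N}}[t]=\mathcal{N}[t+1]\subseteq\mathcal{N}[t]$ is the set of agents that have not crashed by the end of iteration $t$; $\lim_{t\to\infty}\mathcal{N}[t]=\mathcal{N}$. Reduced graphs. A reduced graph of $G(\mathcal{V},\mathcal{E})$ is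 obtained by (i) removing up to $f$ incoming links for each $i\in\mathcal{V}$; and (ii) in the graph so obtained, removing up to $f$ sinks, if any (a sink is a node with no outgoing links). A source component of a directed graph is a strongly connected component that has no incoming link from outside the component. Observations. $\Theta=\{\theta_1,\dots,\theta_m\}$ is a finite set of hypotheses; $\theta^{*}\in\Theta$ is the true one, initially unknown to every agent. Each agent $i$ has a finite private signal space $\mathcal{S}_i$ and distributions $\ell_i(\cdot|\theta)$ on $\mathcal{S}_i$, $\theta\in\Theta$, with $\ell_i(w|\theta)>0$ for all $w\in\mathcal{S}_i$ and $\theta\in\Theta$. The signal $s^i_t$ is the private signal of agent $i$ in iteration $t$; the signal profile $(s^1_t,\dots,s^n_t)$ is generated according to $\ell_1(\cdot|\theta^{*})\times\cdots\times\ell_n(\cdot|\theta^{*})$, and the signals are i.i.d. across iterations. $D\big(\ell_i(\cdot|\theta^{*})\|\ell_i(\cdot|\theta)\big)=\sum_{w\in\mathcal{S}_i}\ell_i(w|\theta^{*})\log\frac{\ell_i(w|\theta^{*})}{\ell_i(w|\theta)}$. Belief update protocol. Each agent $i$ keeps a belief $\mu^i_t$, a probability distribution over $\Theta$, with $\mu^i_0(\theta)=1/m$ for all $\theta\in\Theta$. In iteration $t\ge1$, each agent $i\in\mathcal{N}[t]$ (unless it crashes during the iteration): (1) transmits $\mu^i_{t-1}$, tagged with the iteration index, on all outgoing edges; (2) waits until a private signal $s^i_t$ is observed and belief vectors tagged with iteration $t$ are received from $|\mathcal{I}_i|-f$ incoming neighbors, the set of these neighbors being denoted $\mathcal{R}_i[t]$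 (it may vary with $t$ and need not be monotone); (3) for each $\theta\in\Theta$ sets $$\mu_{t}^i(\theta)= \frac{\ell_i(s_{t}^i|\theta)\prod_{j\in \mathcal{R}_i[t]\cup \{i\}}\mu_{t-1}^j(\theta)^{\frac{1}{|\mathcal{I}_i|-f+1}}}{\sum_{p=1}^m \ell_i(s_{t}^i|\theta_p)\prod_{j\in \mathcal{R}_i[t]\cup \{i\}}\mu_{t-1}^j(\theta_p)^{\frac{1}{|\mathcal{I}_i|-f+1}}}.$$ *)

(* Defs.v *)
From HB Require Import structures.
From mathcomp Require Import all_boot all_order all_algebra.
From mathcomp Require Import all_classical all_reals all_analysis.
Import Order.TTheory GRing.Theory Num.Theory.
Import numFieldNormedType.Exports.

Set Implicit Arguments.
Unset Strict Implicit.
Unset Printing Implicit Defensive.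

Local Open Scope ring_scope.

(* A directed network on the agents 'I_n is given by its set E of links;
   (j, i) \in E is a link from j to i. *)

Definition in_nbrs n (E : {set 'I_n * 'I_n}) (i : 'I_n) : {set 'I_n} :=
  [set j | (j, i) \in E]%SET.

Definition is_sink n (E : {set 'I_n * 'I_n}) (v : 'I_n) : Prop :=
  forall u, (v, u) \notin E.

(* Reduced graphs may have fewer nodes than the network. *)
Record digraph (n : nat) := Digraph {
  nodes : {set 'I_n};
  links : {set 'I_n * 'I_n} }.

(* F is what is left after the first step (removal of links) and Z is the set
   of sinks removed in the second one, all of which are sinks of F itself. *)
Definition reduced_graph n (f : nat) (E : {set 'I_n * 'I_n})
    (H : digraph n) : Prop :=
  exists (F : {set 'I_n * 'I_n}) (Z : {set 'I_n}),
    [/\ F \subset E /\ (forall i, (#|in_nbrs (E :\: F)%SET i| <= f)%N),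
        (forall z, z \in Z -> is_sink F z),
        (#|Z| <= f)%N,
        nodes H = (~: Z)%SET &
        links H = [set e in F | (e.1 \notin Z) && (e.2 \notin Z)]%SET].

Definition reach n (H : digraph n) : rel 'I_n :=
  connect (fun u v => (u, v) \in links H).

Definition strong_component n (H : digraph n) (C : {set 'I_n}) : Prop :=
  exists2 v, v \in nodes H &
    C = [set u in nodes H | reach H u v && reach H v u]%SET.

Definition source_component n (H : digraph n) (C : {set 'I_n}) : Prop :=
  strong_component H C /\
  (forall u v, (u, v) \in links H -> v \in C -> u \in C).

Definition condition1 n (f : nat) (E : {set 'I_n * 'I_n}) : Prop :=
  forall H, reduced_graph f E H ->
    exists! C : {set 'I_n}, source_component H C.

(* Asynchrony and crash faults.  [alive t] is the set of agents that have not
   crashed by the beginning of iteration t (t >= 1; alive 0 is not used), so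
   [alive t.+1] is the set of those that have not crashed by its end, and
   [rcv t i] is the set of incoming neighbors whose iteration-t messages agent i
   uses; only agents in [alive t] transmit in iteration t.  The agents missing
   from [rcv t i] may be merely slow, and may be different at each iteration. *)
Definition crash_execution n (f : nat) (E : {set 'I_n * 'I_n})
    (nonfaulty : {set 'I_n}) (alive : nat -> {set 'I_n})
    (rcv : nat -> 'I_n -> {set 'I_n}) : Prop :=
  [/\ (#|~: nonfaulty|%SET <= f)%N,
      (forall t, (0 < t)%N -> alive t.+1 \subset alive t),
      (exists T, forall t, (T <= t)%N -> alive t = nonfaulty) &
      (forall t i, (0 < t)%N -> i \in alive t.+1 ->
         rcv t i \subset (in_nbrs E i :&: alive t)%SET /\
         #|rcv t i| = (#|in_nbrs E i| - f)%N)].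

Section Observations.
Context {R : realType} {n : nat} {Theta : finType} {S : 'I_n -> finType}.

(* [ell i w theta] is the likelihood l_i(w | theta). *)
Definition likelihoods (ell : forall i, S i -> Theta -> R) : Prop :=
  forall i theta,
    (forall w, 0 < ell i w theta) /\ \sum_(w : S i) ell i w theta = 1.

Definition KL {W : finType} (p q : W -> R) : R :=
  \sum_(w : W) p w * ln (p w / q w).

Definition assumption1 (f : nat) (E : {set 'I_n * 'I_n})
    (ell : forall i, S i -> Theta -> R) : Prop :=
  forall theta thetastar : Theta, theta <> thetastar ->
  forall H C, reduced_graph f E H -> source_component H C ->
    \sum_(i in C) KL (fun w => ell i w thetastar) (fun w => ell i w theta) <> 0.

Context {d : measure_display} {Omega : measurableType d}.

(* Mutual independence of the finitely valued variables X t, t >= 1. *)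
Definition independent_from1 {T : finType} (P : probability Omega R)
    (X : nat -> Omega -> T) : Prop :=
  forall (J : seq nat) (A : nat -> {set T}),
    uniq J -> (forall t, t \in J -> (0 < t)%N) ->
    P [set w | forall t, t \in J -> X t w \in A t]%classic =
    (\prod_(t <- J) P [set w | X t w \in A t]%classic)%E.

(* [s t w i] is the signal of agent i in iteration t >= 1.  The first clause
   says that the profiles are measurable for the discrete sigma-algebra. *)
Definition iid_signals (P : probability Omega R)
    (ell : forall i, S i -> Theta -> R) (thetastar : Theta)
    (s : nat -> Omega -> {dffun forall i : 'I_n, S i}) : Prop :=
  [/\ (forall t (x : {dffun forall i : 'I_n, S i}), (0 < t)%N ->
         measurable [set w | s t w = x]%classic),
      (forall t (x : {dffun forall i : 'I_n, S i}), (0 < t)%N ->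
         P [set w | s t w = x]%classic = (\prod_i ell i (x i) thetastar)%:E) &
      independent_from1 P s].

(* Unnormalised updated belief of an agent i that observes w and uses the
   beliefs nu j of the agents j in rcv and its own. *)
Definition update_weight (f : nat) (E : {set 'I_n * 'I_n})
    (ell : forall i, S i -> Theta -> R) (i : 'I_n) (w : S i)
    (rcv : {set 'I_n}) (nu : 'I_n -> Theta -> R) (theta : Theta) : R :=
  ell i w theta *
  \prod_(j in i |: rcv)
    nu j theta `^ (1 / ((#|in_nbrs E i| - f).+1)%:R).

(* Beliefs are constrained only up to an agent's last completed iteration. *)
Definition runs_protocol (f : nat) (E : {set 'I_n * 'I_n})
    (ell : forall i, S i -> Theta -> R)
    (s : nat -> Omega -> {dffun forall i : 'I_n, S i})
    (alive : nat -> {set 'I_n}) (rcv : nat -> 'I_n -> {set 'I_n})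
    (mu : nat -> 'I_n -> Theta -> Omega -> R) : Prop :=
  (forall i theta w, mu 0%N i theta w = 1 / #|Theta|%:R) /\
  (forall t i theta w, (0 < t)%N -> i \in alive t.+1 ->
     let weight := update_weight f E ell (s t w i) (rcv t i)
                     (fun j theta' => mu t.-1 j theta' w) in
     mu t i theta w = weight theta / \sum_(p : Theta) weight p).

End Observations.

(* Main.v *)
(* Fix theta <> thetastar and let psi_t^i be half the log-likelihood ratio of the
   beliefs of agent i in theta and thetastar; it obeys the linear recursion
   psi_t = A_t psi_(t-1) + L_t, with A_t stochastic and L_t the half log-ratios of
   the likelihoods of the signals.  The expectation of expR (phi . psi_t), for a
   probability vector phi, is bounded by pulling phi back along the A_t: the
   signals of one iteration contribute at most expR (- phi . D), where D_i is the
   squared Hellinger distance of l_i(.|theta) and l_i(.|thetastar).  Hence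
   E expR (psi_t^i) <= expR (- V_t^i), where V_t = A_t V_(t-1) + D and V_0 = 0.
   After the last crash the messages used in each iteration form a reduced graph.
   A set of agents that hears only from itself contains a source component of it,
   hence an agent with D_i > 0, and this makes V grow linearly in t.  So
   expR (psi_t^i) has summable expectations, and tends to 0 almost surely. *)

Require Import Defs.
From HB Require Import structures.
From mathcomp Require Import all_boot all_order all_algebra.
From mathcomp Require Import all_classical all_reals all_analysis.
From mathcomp Require Import measurable_realfun lra.
Import Order.TTheory GRing.Theory Num.Theory.
Import numFieldNormedType.Exports.

Local Open Scope classical_set_scope.
Local Open Scope ring_scope.

Set Implicit Arguments.
Unset Strict Implicit.
Unset Printing Implicit Defensive.

(** * Source components and the graph of received messages *)

(* A member of U with as few ancestors as possible lies in a source component. *)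
Lemma closed_source_component n (H : digraph n) (U : {set 'I_n}) :
  U != finset.set0 -> U \subset nodes H ->
  (forall u v, (u, v) \in links H -> v \in U -> u \in U) ->
  exists2 C, source_component H C & C \subset U.
Proof.
case/set0Pn=> v0 Uv0 subUH closedU.
pose anc v : {set 'I_n} := [set u | reach H u v]%SET.
case: (arg_minnP (fun v => #|anc v|) Uv0) => v Uv minv.
have ancU w : reach H w v -> w \in U.
  case/connectP=> p; elim: p w => [|x p IHp] w /=; first by move=> _ <-.
  by case/andP=> wx xp lastp; apply: closedU wx (IHp _ xp lastp).
exists [set u in nodes H | reach H u v && reach H v u]%SET; last first.
  by apply/fintype.subsetP=> u; rewrite inE => /and3P[_ /ancU].
split; first by exists v => //; apply: (fintype.subsetP subUH).
move=> x y xy; rewrite !inE => /and3P[_ yv vy].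
have xv : reach H x v by apply: connect_trans yv; apply: connect1.
have Ux := ancU x xv.
rewrite (fintype.subsetP subUH) //= xv /=.
(* Ancestors of [x] are ancestors of [v]; minimality forces equality, so [v] also reaches [x]. *)
have sub_anc : anc x \subset anc v.
  by apply/fintype.subsetP=> u; rewrite !inE => /connect_trans; apply.
have /eqP eq_anc : anc x == anc v by rewrite eqEcard sub_anc minv.
have : v \in anc x by rewrite eq_anc inE; apply: connect0.
by rewrite inE.
Qed.

(* Each non-faulty agent ignores at most f incoming links, and the crashed agents,
   at most f of them, become sinks once the links between them are removed too. *)
Lemma received_reduced_graph n (f : nat) (E : {set 'I_n * 'I_n})
    (N : {set 'I_n}) (rc : 'I_n -> {set 'I_n}) :
  (#|~: N|%SET <= f)%N ->
  (forall i, i \in N -> rc i \subset (in_nbrs E i :&: N)%SET /\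
                        #|rc i| = (#|in_nbrs E i| - f)%N) ->
  exists2 H, reduced_graph f E H &
    nodes H = N /\ (forall j i, (j, i) \in links H -> i \in N /\ j \in rc i).
Proof.
move=> cardN rcP.
pose F := [set e in E | if e.2 \in N then e.1 \in rc e.2 else e.1 \in N]%SET.
exists (Digraph (~: ~: N)%SET
  [set e in F | (e.1 \notin ~: N)%SET && (e.2 \notin ~: N)%SET]%SET); last first.
  split; first by rewrite /= finset.setCK.
  by move=> j i; rewrite !inE /= !negbK => /andP[/andP[_ +] /andP[_ iN]]; rewrite iN.
exists F, (~: N)%SET; split => //.
- split; first by apply/fintype.subsetP=> e; rewrite inE => /andP[].
  move=> i; have [iN | iN] := boolP (i \in N).
    have [sub_rc card_rc] := rcP i iN.
    have sub_rcE : rc i \subset in_nbrs E i.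
      by apply: fintype.subset_trans sub_rc _; apply: finset.subsetIl.
    have -> : in_nbrs (E :\: F)%SET i = (in_nbrs E i :\: rc i)%SET.
      apply/setP=> j; rewrite !inE /= iN.
      by case: ((j, i) \in E); rewrite ?andbF //= andbT.
    (* With truncated subtraction, m - (m - f) <= f holds even if m < f. *)
    by rewrite cardsD (finset.setIidPr sub_rcE) card_rc leq_subLR addnC -leq_subLR.
  apply: leq_trans cardN; apply: subset_leq_card; apply/fintype.subsetP=> j.
  by rewrite !inE /= (negbTE iN); case: ((j, i) \in E); rewrite ?andbF //= andbT.
- move=> z; rewrite inE => zN u; rewrite !inE /=.
  apply/negP=> /andP[_]; case: ifP => [uN zu | _ zN']; last by rewrite zN' in zN.
  have [/fintype.subsetP/(_ z zu)] := rcP u uN.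
  by rewrite !inE (negbTE zN) andbF.
Qed.

(** * Linear growth of an averaging recursion with gains *)

(* The agents of N whose value exceeds a common lower bound of V t by gap * b ^+ k
   after k iterations form a set W k.  It grows strictly until it is N: the agents
   outside either hear from W k or form a closed set, and then one of them has a
   gain of its own.  So the minimum of V over N increases by gap * b ^+ n in n
   iterations. *)
Lemma gain_linear_growth (R : realType) n (N : {set 'I_n})
    (rc : nat -> 'I_n -> {set 'I_n}) (a D : 'I_n -> R) (V : nat -> 'I_n -> R)
    (T : nat) (gap : R) :
  0 < gap -> (forall i, 0 <= D i) ->
  (forall i, n.+1%:R^-1 <= a i) ->
  (forall i, V 0%N i = 0) ->
  (forall t i, V t.+1 i = D i + a i * \sum_(j in i |: rc t.+1 i) V t j) ->
  (forall t i, (T <= t)%N -> i \in N ->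
     rc t.+1 i \subset N /\ a i * #|i |: rc t.+1 i|%:R = 1) ->
  (forall t (U : {set 'I_n}), (T <= t)%N -> U != finset.set0 -> U \subset N ->
     (forall i, i \in U -> rc t.+1 i \subset U) ->
     exists2 i, i \in U & gap <= D i) ->
  exists2 eps, 0 < eps &
    exists K, forall t i, i \in N -> eps * t%:R - K <= V t i.
Proof.
move=> gap0 D0 aP V0 VS rcP closedP.
pose b : R := n.+1%:R^-1.
have b0 : 0 < b by rewrite invr_gt0 ltr0n.
have b1 : b <= 1 by rewrite invf_le1 ?ltr0n // ler1n.
have a0 i : 0 < a i by apply: lt_le_trans (aP i).
have Vge0 t i : 0 <= V t i.
  elim: t i => [|t IHt] i; first by rewrite V0.
  by rewrite VS addr_ge0 ?mulr_ge0 ?sumr_ge0 ?(ltW (a0 i)).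
(* On [N] the weights average values that are at least [m]. *)
have VSge t m i : (T <= t)%N -> i \in N -> (forall j, j \in N -> m <= V t j) ->
    D i + m <= V t.+1 i.
  move=> Tt iN mV; rewrite VS lerD2l; have [rcN sum1] := rcP t i Tt iN.
  rewrite -[leLHS]mul1r -sum1 -mulrA ler_wpM2l ?(ltW (a0 i)) // mulr_natl -sumr_const.
  by apply: ler_sum => j /setU1P[-> | /(fintype.subsetP rcN)]; apply: mV.
have step t m : (T <= t)%N -> (forall j, j \in N -> m <= V t j) ->
    forall i, i \in N -> m + gap * b ^+ n <= V (t + n)%N i.
  move=> Tt mV.
  have mVk k i : i \in N -> m <= V (t + k)%N i.
    elim: k i => [|k IHk] i iN; first by rewrite addn0 mV.
    rewrite addnS; apply: le_trans (VSge _ m i _ iN IHk); first by rewrite lerDr.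
    exact: leq_trans (leq_addr _ _).
  pose W k : {set 'I_n} := [set i in N | m + gap * b ^+ k <= V (t + k)%N i]%SET.
  (* The source [j] has weight at least [b] and the other sources are at least [m], so a share [b]
     of the surplus of [j] survives. *)
  have feed k i j : i \in N -> j \in i |: rc (t + k).+1 i -> j \in W k ->
      i \in W k.+1.
    move=> iN ji; rewrite !inE => /andP[jN jV]; rewrite iN addnS VS /=.
    have Ttk : (T <= t + k)%N by exact: leq_trans (leq_addr _ _).
    have [rcN sum1] := rcP _ i Ttk iN.
    apply: (@le_trans _ _ (a i * \sum_(l in i |: rc (t + k).+1 i) V (t + k)%N l));
      last by rewrite lerDr.
    rewrite (bigD1 j) //=.
    apply: (@le_trans _ _ (a i * (gap * b ^+ k + \sum_(l in i |: rc (t + k).+1 i) m))).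
      rewrite sumr_const -[m *+ _]mulr_natl mulrDr [a i * (_ * m)]mulrA sum1 mul1r.
      rewrite addrC lerD2r exprS [leLHS]mulrCA ler_wpM2r //.
      by rewrite mulr_ge0 ?exprn_ge0 ?(ltW gap0) ?(ltW b0).
    rewrite ler_wpM2l ?(ltW (a0 i)) // [in leLHS](bigD1 j) //= addrA lerD //.
      by rewrite addrC.
    apply: ler_sum => l /andP[/setU1P[-> _ | /(fintype.subsetP rcN) lN _]]; exact: mVk.
  have W_mono k : W k \subset W k.+1.
    apply/fintype.subsetP=> i iW; apply: (feed k i i) => //; rewrite ?setU11 //.
    by move: iW; rewrite inE => /andP[].
  have grow k : (k <= #|W k|)%N \/ W k = N.
    elim: k => [|k [IHk | IHk]]; [by left | | right]; last first.
      apply/eqP; rewrite finset.eqEsubset -{2}IHk W_mono andbT.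
      by apply/fintype.subsetP=> i; rewrite inE => /andP[].
    have [WN | WN] := eqVneq (W k) N.
      right; apply/eqP; rewrite finset.eqEsubset -{2}WN W_mono andbT.
      by apply/fintype.subsetP=> i; rewrite inE => /andP[].
    left; apply: leq_ltn_trans IHk _; apply: proper_card.
    apply/properP; split => //.
    have Ttk : (T <= t + k)%N by exact: leq_trans (leq_addr _ _).
    pose U := (N :\: W k)%SET.
    have UN : U \subset N by apply: finset.subsetDl.
    have U0 : U != finset.set0.
      apply: contraNneq WN => U0.
      rewrite finset.eqEsubset -[N \subset _]finset.setD_eq0 -/U U0 eqxx andbT.
      by apply/fintype.subsetP=> i; rewrite inE => /andP[].
    have [/forall_inP closedU | ] := boolP [forall i in U, rc (t + k).+1 i \subset U].
      have [i iU gapi] := closedP _ U Ttk U0 UN closedU.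
      move: (iU); rewrite inE => /andP[iW iN]; exists i => //.
      rewrite inE iN addnS /=.
      apply: le_trans (VSge _ m i Ttk iN (mVk k)).
      rewrite addrC lerD2r; apply: le_trans gapi.
      by rewrite ler_piMr ?(ltW gap0) // exprn_ile1 ?(ltW b0).
    rewrite negb_forall_in => /exists_inP[i iU /subsetPn[j ji jU]].
    move: (iU); rewrite inE => /andP[iW iN]; exists i => //.
    have jN : j \in N by have [/fintype.subsetP/(_ j ji)] := rcP _ i Ttk iN.
    apply: (feed k i j) => //; first by rewrite inE ji orbT.
    by move: jU; rewrite inE jN andbT negbK.
  have WN : W n = N.
    case: (grow n) => // nW.
    have WT : W n = [set: 'I_n]%SET.
      by apply/eqP; rewrite eqEcard finset.subsetT cardsT card_ord.
    apply/eqP; rewrite finset.eqEsubset WT finset.subsetT andbT -WT.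
    by apply/fintype.subsetP=> i; rewrite inE => /andP[].
  by move=> i; rewrite -{1}WN inE => /andP[].
have [n0 | n0] := posnP n.
  by exists 1 => //; exists 0 => t i; subst n; case: i.
pose c := gap * b ^+ n.
have c0 : 0 < c by rewrite mulr_gt0 ?exprn_gt0.
exists (c / n%:R); first by rewrite divr_gt0 ?ltr0n.
(* With this offset the bound is at most 0 before [T + n], where [V] being nonnegative suffices;
   later, [step] goes back [n] iterations. *)
exists (c / n%:R * (T + n)%:R); elim/ltn_ind => t IHt i iN.
have [tT | Tt] := ltnP t (T + n).
  apply: le_trans (Vge0 t i).
  by rewrite -mulrBr pmulr_rle0 ?divr_gt0 ?ltr0n // subr_le0 ler_nat ltnW.
have nt : (n <= t)%N by apply: leq_trans Tt; apply: leq_addl.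
have Ttn : (T <= t - n)%N by rewrite leq_subRL // addnC.
have tn : (t - n < t)%N by rewrite ltn_subrL n0 (leq_trans n0).
have := step _ _ Ttn (IHt _ tn) i iN; rewrite subnK //; apply: le_trans.
rewrite natrB // mulrBr.
have -> : c / n%:R * n%:R = c by rewrite divfK // pnatr_eq0 -lt0n.
by rewrite -/c; lra.
Qed.

(** * Hellinger distance and exponential moments of one signal *)

(** Distributivity when the signal space depends on the agent; it factors the mean over a signal
    profile into means over agents. *)
Lemma big_dffun_prod (R : comNzRingType) (I : finType) (S : I -> finType)
    (h : forall i, S i -> R) :
  \sum_(x : {dffun forall i : I, S i}) \prod_i h i (x i) =
  \prod_i \sum_(w : S i) h i w.
Proof.
pose h' i : {ffun S i -> R} := [ffun w => h i w].
transitivity (\prod_i \sum_(w : S i) h' i w); last first.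
  by apply: eq_bigr => i _; apply: eq_bigr => w _; rewrite ffunE.
transitivity (\sum_(t : fprod S) \prod_(i in I) h' i (t i)).
  rewrite (reindex (@dffun_of_fprod I S)) /=; last first.
    exact/onW_bij/(Bijective (@dffun_of_fprodK I S) (@fprod_of_dffunK I S)).
  by apply: eq_bigr => t _; apply: eq_bigr => i _; rewrite !ffunE.
rewrite big_fprod; under [RHS]eq_bigr do rewrite (big_tag (fun i w => h' i w)).
by rewrite bigA_distr_big_dep.
Qed.

(** The factor 1/2 makes the exponential of this sqrt (y / x), whose mean under the law of x is the
    Hellinger affinity. *)
Definition half_log_ratio {R : realType} (x y : R) : R := 2^-1 * ln (y / x).

Lemma half_log_ratioE (R : realType) (x y : R) : 0 < x -> 0 < y ->
  half_log_ratio x y = 2^-1 * (ln y - ln x).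
Proof. by move=> x0 y0; rewrite /half_log_ratio ln_div ?posrE. Qed.

Section Hellinger.
Context {R : realType} {W : finType}.
Implicit Types p q : W -> R.

(* The squared Hellinger distance, as x * expR (half_log_ratio x y) = sqrt (x * y). *)
Definition hellinger p q : R :=
  1 - \sum_w p w * expR (half_log_ratio (p w) (q w)).

(** With e = sqrt (q / p) pointwise, (p + q) / 2 - p e = p (1 - e)^2 / 2, and (p + q) / 2 has total
    mass 1. *)
Lemma hellingerE p q :
  (forall w, 0 < p w) -> (forall w, 0 < q w) ->
  \sum_w p w = 1 -> \sum_w q w = 1 ->
  hellinger p q = \sum_w p w * (1 - expR (half_log_ratio (p w) (q w))) ^+ 2 / 2.
Proof.
move=> p0 q0 p1 q1; rewrite /hellinger.
have eq1 : 1 = \sum_w (p w + q w) / 2 :> R.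
  by rewrite -mulr_suml big_split /= p1 q1; lra.
rewrite {1}eq1 -sumrB; apply: eq_bigr => w _.
have eq : q w = p w * expR (half_log_ratio (p w) (q w)) ^+ 2.
  rewrite -expRM_natl /half_log_ratio mulrA divff ?mul1r ?pnatr_eq0 //.
  by rewrite lnK ?posrE ?divr_gt0 // mulrC divfK // gt_eqF.
move: eq; set e := expR _ => ->; lra.
Qed.

Lemma hellinger_ge0 p q :
  (forall w, 0 < p w) -> (forall w, 0 < q w) ->
  \sum_w p w = 1 -> \sum_w q w = 1 -> 0 <= hellinger p q.
Proof.
move=> p0 q0 p1 q1; rewrite hellingerE //; apply: sumr_ge0 => w _.
by rewrite divr_ge0 // mulr_ge0 ?sqr_ge0 ?(ltW (p0 w)).
Qed.

(** If the sum of squares vanished, then p = q pointwise and every term of [KL] would be 0. *)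
Lemma hellinger_gt0 p q :
  (forall w, 0 < p w) -> (forall w, 0 < q w) ->
  \sum_w p w = 1 -> \sum_w q w = 1 -> KL p q <> 0 -> 0 < hellinger p q.
Proof.
move=> p0 q0 p1 q1 KL0; rewrite lt_def hellinger_ge0 // andbT.
apply: contra_notN KL0; rewrite hellingerE // psumr_eq0; last first.
  by move=> w _; rewrite divr_ge0 // mulr_ge0 ?sqr_ge0 ?(ltW (p0 w)).
move/allP=> eq0; rewrite /KL big1 // => w _.
have := eq0 w (mem_index_enum w); rewrite !mulf_eq0 invr_eq0 pnatr_eq0 orbF.
rewrite gt_eqF //= orbb subr_eq0 eq_sym => /eqP; rewrite -[in RHS]expR0.
move/expR_inj/eqP; rewrite mulf_eq0 invr_eq0 pnatr_eq0 /= ln_eq0 ?divr_gt0 //.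
move/eqP=> qp; have -> : q w = p w.
  by rewrite -[LHS](divfK (lt0r_neq0 (p0 w))) qp mul1r.
by rewrite divff ?gt_eqF // ln1 mulr0.
Qed.

Lemma expR_le_chord (a y : R) : 0 <= a <= 1 -> expR (a * y) <= 1 - a + a * expR y.
Proof.
case/andP=> a0 a1; have := convex_expR (Itv01 a0 a1) (y : R^o) (0 : R^o).
by rewrite !convRE /= /unstable.onem expR0 mulr0 addr0 mulr1 addrC.
Qed.

(** Convexity of the exponential bounds the left side by 1 - a * [hellinger p q], and 1 + x <= exp x
    does the rest. *)
Lemma chernoff_hellinger p q (a : R) :
  (forall w, 0 < p w) -> \sum_w p w = 1 -> 0 <= a <= 1 ->
  \sum_w p w * expR (a * half_log_ratio (p w) (q w)) <= expR (- (a * hellinger p q)).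
Proof.
move=> p0 p1 a01; apply: le_trans (expR_ge1Dx _).
apply: (@le_trans _ _ (\sum_w p w * (1 - a + a * expR (half_log_ratio (p w) (q w))))).
  by apply: ler_sum => w _; rewrite ler_wpM2l ?(ltW (p0 w)) ?expR_le_chord.
under eq_bigr do rewrite mulrDr mulrCA.
by rewrite big_split /= -mulr_suml -mulr_sumr p1 /hellinger; lra.
Qed.
End Hellinger.

(** * Independence across iterations and almost sure convergence *)

Section Expectation.
Context {R : realType} {d : measure_display} {Omega : measurableType d}
  {P : probability Omega R}.

(** The product is constant on each cell [B y] of the finite partition of [Omega] by signal history,
    and independence gives the mass of each cell. *)
Lemma integral_prod_iid (T : finType) (X : nat -> Omega -> T) (p : T -> R)
    (g : nat -> T -> R) t :
  (forall r x, (0 < r)%N -> measurable [set w | X r w = x]) ->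
  (forall r x, (0 < r)%N -> P [set w | X r w = x] = (p x)%:E) ->
  independent_from1 P X -> (forall r x, 0 <= g r x) ->
  measurable_fun [set: Omega]
    (fun w => (\prod_(1 <= r < t.+1) g r (X r w))%:E : \bar R) /\
  (\int[P]_w (\prod_(1 <= r < t.+1) g r (X r w))%:E =
   (\prod_(1 <= r < t.+1) \sum_x p x * g r x)%:E)%E.
Proof.
move=> Xmeas Xdist Xind g0.
pose history w : {ffun 'I_t -> T} := [ffun i => X (val i).+1 w].
pose B (y : {ffun 'I_t -> T}) : set Omega := [set w | history w = y].
pose c (y : {ffun 'I_t -> T}) := \prod_(i < t) g i.+1 (y i).
have c0 y : 0 <= c y by apply: prodr_ge0.
have historyP y w : B y w <-> forall i, X (val i).+1 w = y i.
  split=> [<- i | wy]; first by rewrite ffunE.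
  by apply/ffunP=> i; rewrite ffunE.
have B_meas y : measurable (B y).
  have -> : B y = \big[setI/setT]_(i <- enum 'I_t) [set w | X (val i).+1 w = y i].
    rewrite -bigcap_seq; apply/seteqP; split => w.
      by move/historyP=> wy i _; apply: wy.
    by move=> wy; apply/historyP=> i; apply: wy; rewrite /= mem_enum.
  by apply: bigsetI_measurable => i _; apply: Xmeas.
have PB y : P (B y) = (\prod_(i < t) p (y i))%:E.
  pose J := [seq (val i).+1 | i <- enum 'I_t].
  (* Iterations are numbered from 1 but ['I_t] from 0, hence [r.-1]; [finset.setT] is the default
     when [r.-1] is not below [t]. *)
  pose A r : {set T} := if insub r.-1 is Some i then [set y i]%SET else finset.setT.
  have AE (i : 'I_t) : A (val i).+1 = [set y i]%SET by rewrite /A /= valK.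
  have BE : B y = [set w | forall r, r \in J -> X r w \in A r].
    apply/seteqP; split => w.
      by move/historyP=> wy r /mapP[i _ ->]; rewrite AE inE; apply/eqP; apply: wy.
    move=> wA; apply/historyP=> i; apply/eqP.
    by have := wA _ (map_f _ (mem_enum _ i)); rewrite AE inE.
  rewrite BE Xind; last by move=> r /mapP[i _ ->].
    rewrite big_map big_enum /= -prodEFin; apply: eq_bigr => i _.
    rewrite AE -(Xdist (val i).+1) //; congr (P _); apply/seteqP.
    by split=> w /=; rewrite inE => /eqP.
  by rewrite map_inj_uniq ?enum_uniq // => i j [] /val_inj.
have prodE w : \prod_(1 <= r < t.+1) g r (X r w) = \sum_y c y * \1_(B y) w.
  rewrite big_add1 big_mkord (bigD1 (history w)) //= [X in _ + X]big1 ?addr0.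
    rewrite indicE mem_set // mulr1; apply: eq_bigr => i _; rewrite ffunE //.
  move=> y yw; rewrite indicE memNset ?mulr0 // => /= wy.
  by rewrite wy eqxx in yw.
have cB_meas y : measurable_fun [set: Omega] (fun w => (c y * \1_(B y) w)%:E : \bar R).
  by apply/measurable_EFinP; apply: measurable_funM => //; apply: measurable_indic.
have -> : (fun w => (\prod_(1 <= r < t.+1) g r (X r w))%:E) =
    (fun w => \sum_y (c y * \1_(B y) w)%:E)%E.
  by apply/funext=> w /=; rewrite prodE sumEFin.
split; first exact: emeasurable_sum.
rewrite ge0_integral_sum //; last by move=> y w _; rewrite lee_fin mulr_ge0.
(* Expanding the product of sums gives one term per history. *)
rewrite big_add1 big_mkord bigA_distr_bigA /= -sumEFin; apply: eq_bigr => y _.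
under eq_integral do rewrite EFinM.
rewrite ge0_integralZl_EFin //; last by apply/measurable_EFinP; apply: measurable_indic.
rewrite integral_indic // setIT big_split /= mulrC EFinM.
by congr (_ * _)%E; apply: PB.
Qed.

(** The series of the [u t] has a finite integral, so it converges almost surely and its terms tend
    to 0. *)
Lemma ae_geometric_cvg0 (u : nat -> Omega -> R) (K q : R) :
  0 < q < 1 -> (forall t w, 0 <= u t w) ->
  (forall t, measurable_fun [set: Omega] (EFin \o u t)) ->
  (forall t, (\int[P]_w (u t w)%:E <= (K * q ^+ t)%:E)%E) ->
  {ae P, forall w, u t w @[t --> \oo] --> 0}.
Proof.
case/andP=> q0 q1 u0 um uK.
have K0 : 0 <= K.
  have := uK 0%N; rewrite expr0 mulr1 -lee_fin; apply: le_trans.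
  by apply: integral_ge0 => w _; rewrite lee_fin.
have sum_fin : (\int[P]_w (\sum_(t <oo) (u t w)%:E) < +oo)%E.
  rewrite integral_nneseries //; last by move=> *; rewrite lee_fin.
  apply: (@le_lt_trans _ _ (K / (1 - q))%:E); last exact: ltry.
  apply: lime_le.
    by apply: is_cvg_nneseries => t _ _; apply: integral_ge0 => w _; rewrite lee_fin.
  near=> m; apply: (@le_trans _ _ (\sum_(0 <= t < m) (K * q ^+ t)%:E)%E).
    by apply: lee_sum => t _.
  rewrite sumEFin lee_fin.
  by apply: (geometric_le_lim m K0); rewrite ?ger0_norm // ltW.
have sum_ge0 w : (0 <= \sum_(t <oo) (u t w)%:E)%E.
  by apply: nneseries_ge0 => t _ _; rewrite lee_fin.
have int_sum : P.-integrable setT (fun w => \sum_(t <oo) (u t w)%:E)%E.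
  apply/integrableP; split.
    apply: ge0_emeasurable_sum => [t w _ _ | t _]; first by rewrite lee_fin.
    exact: um.
  by under eq_integral do rewrite gee0_abs //.
apply: filterS (integrable_ae measurableT int_sum) => w /(_ I) w_fin.
apply: cvg_series_cvg_0; apply: nnseries_is_cvg => //.
by rewrite -ge0_fin_numE.
Unshelve. all: by end_near. Qed.
End Expectation.

(** * Log-linear form of the belief updates *)

Section Protocol.
Context {R : realType} {n f : nat} {E : {set 'I_n * 'I_n}} {Theta : finType}
  {S : 'I_n -> finType} {ell : forall i, S i -> Theta -> R}
  {d : measure_display} {Omega : measurableType d}
  {s : nat -> Omega -> {dffun forall i : 'I_n, S i}}
  {nonfaulty : {set 'I_n}} {alive : nat -> {set 'I_n}}
  {rcv : nat -> 'I_n -> {set 'I_n}} {mu : nat -> 'I_n -> Theta -> Omega -> R}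
  {P : probability Omega R}
  (no_loops : forall i : 'I_n, (i, i) \notin E)
  (ell_dist : likelihoods ell)
  (execution : crash_execution f E nonfaulty alive rcv)
  (protocol : runs_protocol f E ell s alive rcv mu)
  (theta thetastar : Theta).

Definition share (i : 'I_n) : R := 1 / ((#|in_nbrs E i| - f).+1)%:R.

Lemma share_ge i : n.+1%:R^-1 <= share i.
Proof.
rewrite /share mul1r lef_pV2 ?posrE ?ltr0n // ler_nat ltnS.
by apply: leq_trans (leq_subr _ _) _; rewrite -[leqRHS](card_ord n) max_card.
Qed.

(** Allows induction on time: beliefs are constrained only for agents that completed the previous
    iteration. *)
Lemma sources_alive t i : i \in alive t.+2 -> i |: rcv t.+1 i \subset alive t.+1.
Proof.
case: execution => _ alive_dec _ rcvP it; have [rcv_sub _] := rcvP t.+1 i isT it.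
apply/fintype.subsetP=> j /setU1P[-> | /(fintype.subsetP rcv_sub)].
  exact: (fintype.subsetP (alive_dec t.+1 isT)).
by rewrite inE => /andP[].
Qed.

(** Without self-loops, agent [i] is counted once beside its senders, so the averaging weights sum
    to 1. *)
Lemma share_sources t i : i \in alive t.+2 ->
  share i * #|i |: rcv t.+1 i|%:R = 1.
Proof.
case: execution => _ _ _ rcvP it; have [rcv_sub card_rcv] := rcvP t.+1 i isT it.
have i_rcv : i \notin rcv t.+1 i.
  apply/negP=> /(fintype.subsetP rcv_sub); rewrite !inE => /andP[].
  by rewrite (negbTE (no_loops i)).
by rewrite cardsU1 i_rcv card_rcv /share mul1r mulVf // pnatr_eq0.
Qed.

Lemma update_weight_gt0 i (w : S i) (A : {set 'I_n}) (nu : 'I_n -> Theta -> R) p :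
  (forall j, j \in i |: A -> 0 < nu j p) -> 0 < update_weight f E ell w A nu p.
Proof.
move=> nu0; rewrite mulr_gt0 ?(proj1 (ell_dist i p)) //.
by apply: prodr_gt0 => j jA; rewrite powR_gt0 ?nu0.
Qed.

Lemma update_weight_sum_gt0 i (w : S i) (A : {set 'I_n})
    (nu : 'I_n -> Theta -> R) (p : Theta) :
  (forall q j, j \in i |: A -> 0 < nu j q) ->
  0 < \sum_q update_weight f E ell w A nu q.
Proof.
move=> nu0; rewrite (bigD1 p) //=; apply: ltr_wpDr; last exact/update_weight_gt0/nu0.
by apply: sumr_ge0 => q _; rewrite ltW // update_weight_gt0 // => j; apply: nu0.
Qed.

Lemma belief_gt0 t i p w : i \in alive t.+1 -> 0 < mu t i p w.
Proof.
case: protocol => mu0 muS; elim: t i p => [|t IHt] i p it.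
  by rewrite mu0 divr_gt0 ?ltr01 // ltr0n; apply/card_gt0P; exists p.
have mu_gt0 q j : j \in i |: rcv t.+1 i -> 0 < mu t j q w.
  by move=> ji; apply/IHt/(fintype.subsetP (sources_alive it)).
rewrite muS //=; apply: divr_gt0; first exact/update_weight_gt0/mu_gt0.
exact: (update_weight_sum_gt0 _ p mu_gt0).
Qed.

Lemma belief_sum1 t i w : i \in alive t.+2 -> \sum_p mu t.+1 i p w = 1.
Proof.
move=> it; case: protocol => _ muS.
under eq_bigr do rewrite muS //=.
rewrite -mulr_suml mulfV // gt_eqF // (update_weight_sum_gt0 _ theta) // => q j ji.
exact/belief_gt0/(fintype.subsetP (sources_alive it)).
Qed.

Definition belief_ratio t i w : R :=
  half_log_ratio (mu t i thetastar w) (mu t i theta w).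

Definition evidence i (w : S i) : R :=
  half_log_ratio (ell w thetastar) (ell w theta).

Lemma ln_update_weight i (w : S i) (A : {set 'I_n}) (nu : 'I_n -> Theta -> R) p :
  (forall j, j \in i |: A -> 0 < nu j p) ->
  ln (update_weight f E ell w A nu p) =
  ln (ell w p) + share i * \sum_(j in i |: A) ln (nu j p).
Proof.
move=> nu0; rewrite lnM ?posrE ?(proj1 (ell_dist i p)) //; last first.
  by apply: prodr_gt0 => j jA; rewrite powR_gt0 ?nu0.
congr (_ + _); rewrite mulr_sumr.
rewrite -[RHS]expRK expR_sum; congr ln; apply: eq_bigr => j jA.
by rewrite /powR gt_eqF ?nu0.
Qed.

(** The normalising sum is common to both hypotheses and cancels; logarithms turn the geometric mean
    into an arithmetic one. *)
Lemma belief_ratioS t i w : i \in alive t.+2 ->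
  belief_ratio t.+1 i w =
  evidence (s t.+1 w i) + share i * \sum_(j in i |: rcv t.+1 i) belief_ratio t j w.
Proof.
move=> it; have [_ muS] := protocol.
have src := fintype.subsetP (sources_alive it).
have mu_gt0 p j : j \in i |: rcv t.+1 i -> 0 < mu t j p w.
  by move=> /src; apply: belief_gt0.
pose nu j q := mu t j q w.
have weight0 p := update_weight_gt0 (nu := nu) (s t.+1 w i) (mu_gt0 p).
have sum0 := update_weight_sum_gt0 (nu := nu) (s t.+1 w i) theta mu_gt0.
rewrite /belief_ratio half_log_ratioE ?belief_gt0 // !muS //= !ln_div ?posrE //.
rewrite !ln_update_weight //; try exact: mu_gt0.
under [in RHS]eq_bigr => j ji do rewrite half_log_ratioE ?mu_gt0 //.
rewrite -mulr_sumr sumrB /evidence half_log_ratioE ?(proj1 (ell_dist i _)) //.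
set sum := \sum_p _; lra.
Qed.

(** * Exponential moments of the belief ratios *)

Definition gain i : R :=
  hellinger (fun w : S i => ell w thetastar) (fun w => ell w theta).

(** The recursion of [belief_ratioS] with [gain] in place of the random [evidence]. *)
Fixpoint total_gain t i : R :=
  if t is t'.+1 then
    gain i + share i * \sum_(j in i |: rcv t i) total_gain t' j
  else 0.

Definition profile_prob (x : {dffun forall i : 'I_n, S i}) : R :=
  \prod_i ell (x i) thetastar.

Lemma profile_chernoff (phi : 'I_n -> R) :
  (forall i, 0 <= phi i <= 1) ->
  \sum_x profile_prob x * expR (\sum_i phi i * evidence (x i)) <=
  expR (- \sum_i phi i * gain i).
Proof.
move=> phi01; under eq_bigr do rewrite expR_sum -big_split /=.
rewrite (big_dffun_prod (fun i w => ell w thetastar * expR (phi i * evidence w))).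
rewrite -sumrN expR_sum; apply: ler_prod => i _.
rewrite sumr_ge0 /=; last first.
  by move=> w _; rewrite mulr_ge0 ?expR_ge0 // ltW // (proj1 (ell_dist i _)).
apply: (@chernoff_hellinger _ _ (fun w => ell w thetastar) (fun w => ell w theta)) => //.
  exact: (proj1 (ell_dist i _)).
exact: (proj2 (ell_dist i _)).
Qed.

(* Writing the left-hand side as a product over the iterations, for every phi at
   once, makes the induction purely algebraic: independence is used only when
   this product is integrated. *)
Lemma belief_ratio_factor t (phi : 'I_n -> R) :
  (forall i, 0 <= phi i) -> \sum_i phi i = 1 ->
  (forall i, i \notin alive t.+1 -> phi i = 0) ->
  exists g : nat -> {dffun forall i : 'I_n, S i} -> R,
  [/\ forall r x, 0 <= g r x,
      forall w, expR (\sum_i phi i * belief_ratio t i w) =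
                \prod_(1 <= r < t.+1) g r (s r w) &
      \prod_(1 <= r < t.+1) \sum_x profile_prob x * g r x <=
      expR (- \sum_i phi i * total_gain t i)].
Proof.
elim: t phi => [|t IHt] phi phi0 phi1 phi_alive.
  exists (fun _ _ => 1); split => // [w|].
    rewrite big_nil big1 ?expR0 // => i _.
    by case: protocol => mu0 _; rewrite /belief_ratio !mu0 /half_log_ratio divff
      ?ln1 ?mulr0 // mulf_neq0 ?invr_eq0 ?oner_eq0 // pnatr_eq0 -lt0n;
      apply/card_gt0P; exists theta.
  by rewrite big_nil big1 ?oppr0 ?expR0 // => i _; rewrite mulr0.
pose src i := i |: rcv t.+1 i.
(* [psi] is [phi] times the averaging matrix of iteration [t.+1]; it is again a probability vector,
   carried by agents that completed iteration [t]. *)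
pose psi j := \sum_(i | j \in src i) phi i * share i.
have psiE v : \sum_j psi j * v j = \sum_i phi i * (share i * \sum_(j in src i) v j).
  under eq_bigr do rewrite mulr_suml.
  rewrite (exchange_big_dep predT) //=; apply: eq_bigr => i _.
  by rewrite mulrA mulr_sumr.
have share0 i : 0 < share i by apply: lt_le_trans (share_ge i); rewrite invr_gt0 ltr0n.
have phi_supp i : phi i = 0 \/ i \in alive t.+2.
  by have [it | /phi_alive] := boolP (i \in alive t.+2); [right | left].
have psi0 j : 0 <= psi j.
  by apply: sumr_ge0 => i _; rewrite mulr_ge0 ?(ltW (share0 i)).
have psi1 : \sum_j psi j = 1.
  rewrite -phi1; under eq_bigr do rewrite -[psi _]mulr1.
  rewrite (psiE (fun=> 1)); apply: eq_bigr => i _.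
  case: (phi_supp i) => [-> | it]; first by rewrite mul0r.
  by rewrite sumr_const share_sources ?mulr1.
have psi_alive j : j \notin alive t.+1 -> psi j = 0.
  move=> jt; apply: big1 => i ji; case: (phi_supp i) => [-> | it]; first by rewrite mul0r.
  by rewrite (fintype.subsetP (sources_alive it) j ji) in jt.
have [g [g0 gE g_le]] := IHt psi psi0 psi1 psi_alive.
pose h (x : {dffun forall i : 'I_n, S i}) := expR (\sum_i phi i * evidence (x i)).
pose g' r := if r == t.+1 then h else g r.
have g'E : g' t.+1 = h by rewrite /g' eqxx.
have g'_lt r : (1 <= r < t.+1)%N -> g' r = g r.
  by case/andP=> _ rt; rewrite /g' ltn_eqF.
exists g'; split.
- by move=> r x; rewrite /g'; case: eqP => // _; rewrite expR_ge0.
- move=> w; rewrite big_nat_recr //= g'E.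
  under eq_big_nat => r rt do rewrite g'_lt //.
  rewrite -gE -expRD psiE -big_split /=; congr expR; apply: eq_bigr => i _.
  case: (phi_supp i) => [-> | it]; first by rewrite !mul0r addr0.
  by rewrite belief_ratioS // mulrDr addrC.
- rewrite big_nat_recr //= g'E.
  under eq_big_nat => r rt do rewrite g'_lt //.
  under [in leRHS]eq_bigr do rewrite mulrDr.
  rewrite big_split /= opprD expRD mulrC -psiE.
  apply: ler_pM g_le.
  + by apply: sumr_ge0 => x _; rewrite mulr_ge0 ?expR_ge0 // prodr_ge0 // => i _;
      rewrite ltW // (proj1 (ell_dist i _)).
  + apply: prodr_ge0 => r _; apply: sumr_ge0 => x _.
    by rewrite mulr_ge0 // prodr_ge0 // => i _; rewrite ltW // (proj1 (ell_dist i _)).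
  (* The coordinates of a probability vector are at most 1, as the chord bound requires. *)
  + apply: profile_chernoff => i; rewrite phi0 -phi1 (bigD1 i) //= lerDl.
    exact: sumr_ge0.
Qed.

(** * Decay of the beliefs in false hypotheses *)

Lemma gain_ge0 i : 0 <= gain i.
Proof.
by apply: hellinger_ge0; try exact: (proj1 (ell_dist i _));
  exact: (proj2 (ell_dist i _)).
Qed.

(** [U] contains a source component of the reduced graph of received messages, and there the
    divergences cannot all vanish. *)
Lemma closed_has_gain (assum1 : assumption1 f E ell) (neq : theta <> thetastar) t
    (U : {set 'I_n}) :
  alive t.+1 = nonfaulty -> alive t.+2 = nonfaulty ->
  U != finset.set0 -> U \subset nonfaulty ->
  (forall i, i \in U -> rcv t.+1 i \subset U) ->
  exists2 i, i \in U & 0 < gain i.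
Proof.
move=> at1 at2 U0 UN closedU; case: execution => cardN _ _ rcvP.
have [|H redH [nodesH linksH]] :=
  received_reduced_graph (E := E) (rc := rcv t.+1) cardN.
  by move=> i iN; rewrite -{1}at1; apply: rcvP => //; rewrite at2.
have [|u v /linksH[vN uv] vU|C srcC CU] := closed_source_component (H := H) U0.
- by rewrite nodesH.
- exact: (fintype.subsetP (closedU v vU)).
have [i iC KL0] : exists2 i, i \in C &
    KL (fun w : S i => ell w thetastar) (fun w => ell w theta) <> 0.
  apply: contrapT => noKL; apply: (assum1 _ _ neq _ _ redH srcC); apply: big1 => i iC.
  by apply: contrapT => KL0; apply: noKL; exists i.
exists i; first exact: (fintype.subsetP CU).
by apply: hellinger_gt0 => //; try exact: (proj1 (ell_dist i _));
  exact: (proj2 (ell_dist i _)).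
Qed.

Lemma total_gain_linear_growth (assum1 : assumption1 f E ell)
    (neq : theta <> thetastar) :
  exists2 eps, 0 < eps &
    exists K, forall t i, i \in nonfaulty -> eps * t%:R - K <= total_gain t i.
Proof.
case: (execution) => _ _ [T aliveT] rcvP.
have alive1 t : (T <= t)%N -> alive t.+1 = nonfaulty.
  by move=> Tt; rewrite aliveT // ltnW.
have alive2 t : (T <= t)%N -> alive t.+2 = nonfaulty.
  by move=> Tt; rewrite alive1 // ltnW.
(* The default 1 keeps [gap] positive when no gain is. *)
pose gap := \big[Num.min/1]_(i | 0 < gain i) gain i.
apply: (@gain_linear_growth _ _ _ rcv share gain total_gain T gap) => //.
- by rewrite /gap; apply: lt_bigmin.
- exact: gain_ge0.
- exact: share_ge.
- move=> t i Tt iN; have it : i \in alive t.+2 by rewrite alive2.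
  split; last exact: share_sources.
  rewrite -(alive1 t Tt); apply: fintype.subset_trans _ (sources_alive it).
  exact: finset.subsetUr.
- move=> t U Tt U0 UN closedU.
  have [i iU gain0] :=
    closed_has_gain assum1 neq (alive1 t Tt) (alive2 t Tt) U0 UN closedU.
  by exists i => //; apply: bigmin_le_cond.
Qed.

Lemma belief_quotient_cvg0 (assum1 : assumption1 f E ell)
    (neq : theta <> thetastar) (signals : iid_signals P ell thetastar s) i :
  i \in nonfaulty ->
  {ae P, forall w, mu t i theta w / mu t i thetastar w @[t --> \oo] --> 0}.
Proof.
move=> iN; case: (signals) => s_meas s_dist s_ind.
have [eps eps0 [K growth]] := total_gain_linear_growth assum1 neq.
case: (execution) => _ _ [T aliveT] _.
have it t : i \in alive (t + T).+1 by rewrite aliveT // -addSn leq_addl.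
pose u t w := expR (belief_ratio (t + T) i w).
(* The point mass at [i] singles out the belief ratio of agent [i]. *)
pose phi j : R := (j == i)%:R.
have phiE v : \sum_j phi j * v j = v i.
  rewrite (bigD1 i) //= /phi eqxx mul1r big1 ?addr0 // => j /negbTE->.
  by rewrite mul0r.
have factor t := @belief_ratio_factor (t + T) phi (fun j => ler0n _ _).
have {}factor t : exists g : nat -> {dffun forall i : 'I_n, S i} -> R,
  [/\ forall r x, 0 <= g r x,
      forall w, u t w = \prod_(1 <= r < (t + T).+1) g r (s r w) &
      \prod_(1 <= r < (t + T).+1) \sum_x profile_prob x * g r x <=
      expR (- total_gain (t + T) i)].
  case: (factor t).
    by under eq_bigr do rewrite -[phi _]mulr1; rewrite (phiE (fun=> 1)).
    by move=> j; rewrite /phi; case: eqP => // ->; rewrite it.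
  by move=> g [g0 gE g_le]; exists g; split => // [w|]; rewrite -?gE ?phiE // -phiE.
have : {ae P, forall w, u t w @[t --> \oo] --> 0}.
  (* These constants come from exp (K - eps (t + T)) = exp (K - eps T) * exp (- eps)^t. *)
  apply: (@ae_geometric_cvg0 _ _ _ _ _ (expR (K - eps * T%:R)) (expR (- eps))).
  - by rewrite expR_gt0 expR_lt1 oppr_lt0.
  - by move=> t w; rewrite expR_ge0.
  - move=> t; have [g [g0 gE _]] := factor t.
    have -> : EFin \o u t = (fun w => (\prod_(1 <= r < (t + T).+1) g r (s r w))%:E).
      by apply/funext => w /=; rewrite gE.
    by have [] := integral_prod_iid (t + T) s_meas s_dist s_ind g0.
  - move=> t; have [g [g0 gE g_le]] := factor t.
    under eq_integral do rewrite gE.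
    have [_ ->] := integral_prod_iid (t + T) s_meas s_dist s_ind g0.
    rewrite lee_fin; apply: le_trans g_le _.
    rewrite -expRM_natr -expRD ler_expR; have := growth (t + T)%N i iN.
    by rewrite natrD; lra.
apply: filterS => w u_cvg; rewrite -(cvg_shiftn T).
(* [belief_ratio] is half a logarithm, so the quotient is the square of [u]. *)
have -> : (fun t => mu (t + T)%N i theta w / mu (t + T)%N i thetastar w) =
    (fun t => u t w * u t w).
  apply/funext => t; rewrite -expr2 -expRM_natl mulrA divff ?pnatr_eq0 // mul1r.
  by rewrite lnK // posrE divr_gt0 // belief_gt0.
have uu_cvg := cvgM u_cvg u_cvg; rewrite mulr0 in uu_cvg.
exact: uu_cvg.
Qed.
End Protocol.

(** * Convergence of the belief in the true hypothesis *)

Theorem theorem3 (R : realType) (n f : nat) (E : {set 'I_n * 'I_n})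
    (Theta : finType) (S : 'I_n -> finType)
    (ell : forall i : 'I_n, S i -> Theta -> R)
    (d : measure_display) (Omega : measurableType d) (P : probability Omega R)
    (thetastar : Theta) (s : nat -> Omega -> {dffun forall i : 'I_n, S i})
    (nonfaulty : {set 'I_n}) (alive : nat -> {set 'I_n})
    (rcv : nat -> 'I_n -> {set 'I_n})
    (mu : nat -> 'I_n -> Theta -> Omega -> R)
    (no_loops : forall i : 'I_n, (i, i) \notin E)
    (ell_dist : likelihoods ell)
    (cond1 : condition1 f E)
    (assum1 : assumption1 f E ell)
    (signals : iid_signals P ell thetastar s)
    (execution : crash_execution f E nonfaulty alive rcv)
    (protocol : runs_protocol f E ell s alive rcv mu) :
  forall i : 'I_n, i \in nonfaulty ->
    {ae P, forall w, (fun t : nat => mu t i thetastar w) @ \oo --> (1 : R)}.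
Proof.
move=> i iN; case: (execution) => _ _ [T aliveT] _.
have it t : i \in alive (t + T).+1 by rewrite aliveT // -addSn leq_addl.
have quotient_cvg theta :
    {ae P, forall w, mu t i theta w / mu t i thetastar w @[t --> \oo] -->
                     ((theta == thetastar)%:R : R)}.
  case: eqP => [-> | neq]; last first.
    exact: (belief_quotient_cvg0 no_loops ell_dist execution protocol assum1
      neq signals iN).
  apply: aeW => w; rewrite -(cvg_shiftn T).
  have -> : (fun t => mu (t + T)%N i thetastar w / mu (t + T)%N i thetastar w) = fun=> 1.
    apply/funext => t.
    by rewrite divff // gt_eqF // (belief_gt0 ell_dist execution protocol).
  exact: cvg_cst.
have all_cvg : {ae P, forall w, forall theta,
    mu t i theta w / mu t i thetastar w @[t --> \oo] -->
      ((theta == thetastar)%:R : R)} by apply: filter_forall.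
(* The shift is [T.+1] because [belief_sum1] concerns iterations from 1 on. *)
apply: filterS all_cvg => w cvg_w; rewrite -(cvg_shiftn T.+1).
(* As beliefs sum to 1, the belief in [thetastar] is the inverse of the sum of all quotients, and
   only the quotient at [thetastar] survives in the limit. *)
have -> : (fun t => mu (t + T.+1)%N i thetastar w) =
  (fun t => (\sum_theta mu (t + T.+1)%N i theta w /
                        mu (t + T.+1)%N i thetastar w)^-1).
  apply/funext => t; rewrite -mulr_suml addnS.
  by rewrite (belief_sum1 ell_dist execution protocol) // ?mul1r ?invrK // -addSn it.
have sum1 : \sum_theta (theta == thetastar)%:R = 1 :> R.
  by rewrite (bigD1 thetastar) //= eqxx big1 ?addr0 // => theta /negbTE->.
have sum_cvg :
    \sum_theta mu (t + T.+1)%N i theta w / mu (t + T.+1)%N i thetastar w @[t --> \oo]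
    --> (1 : R).
  rewrite -sum1; apply: (cvg_big add_continuous) => theta _.
  rewrite (cvg_shiftn T.+1 (fun t => mu t i theta w / mu t i thetastar w)).
  exact: cvg_w.
have inv_cvg := cvgV (oner_neq0 R) sum_cvg; rewrite invr1 in inv_cvg.
exact: inv_cvg.
Qed.
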